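(* The cofinality of $\mathfrak{Z}(\mathcal{S})$ is uncountable: $\mathrm{cf}(\mathfrak{Z}(\mathcal{S}))>\omega$. Consequently $\mathfrak{Z}(\mathcal{S})\geq\omega_1$.
   Context: An LMP is a triple $\mathbb{S}=(S,\Sigma,\{\tau_a\mid a\in L\})$ with $(S,\Sigma)$ a measurable space, $L$ a countable label set, and each $\tau_a:S\times\Sigma\to[0,1]$ a Markov kernel (subprobability measure in the second argument, measurable in the first). It is separable if $\Sigma$ is countably generated and separates points of $S$. For $R\subseteq S\times S$, $\Sigma(R)$ is the family of $R$-closed sets in $\Sigma$ ($A$ is $R$-closed if $x\in A$, $xRs$ imply $s\in A$). $\mathcal{R}(\Gamma)=\{(s,t):\forall A\in\Gamma\,(s\in A\iff t\in A)\}$; $\mathcal{R}^T(\Lambda)=\{(s,t):\forall a\,\forall E\in\Lambda\ \tau_a(s,E)=\tau_a(t,E)\}$; $\mathcal{O}(R)=\mathcal{R}^T(\Sigma(R))$, with iterates $\mathcal{O}^0(R)=R$, $\mathcal{O}^{\alpha+1}(R)=\mathcal{O}(\mathcal{O}^\alpha(R))$, $\mathcal{O}^\lambda(R)=\bigcap_{\alpha<\lambda}\mathcal{O}^\alpha(R)$ for limit $\lambda$. Event bisimilarity ${\sim_e}=\mathcal{R}(\sigma(\llbracket\mathcal{L}\rrbracket))$, where $\sigma(\llbracket\mathcal{L}\rrbracket)$ is the $\sigma$-algebra generated by the denotations of formulas $\phi::=\top\mid\phi\wedge\psi\mid\langle a\rangle_{>q}\phi$ ($q\in\mathbb{Q}\cap[0,1]$),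 $\llbracket\langle a\rangle_{>q}\phi\rrbracket=\{s:\tau_a(s,\llbracket\phi\rrbracket)>q\}$. A state bisimulation is a symmetric $R$ with $sRt$, $C\in\Sigma(R)$ implying $\tau_a(s,C)=\tau_a(t,C)$ for all $a$; state bisimilarity $\sim_s$ is the union of all state bisimulations. The Zhou ordinal $\mathfrak{Z}(\mathbb{S})$ is the least $\alpha$ with $\mathcal{O}^\alpha(\sim_e)={\sim_s}$. $\mathfrak{Z}(\mathcal{S})$ is the supremum of $\mathfrak{Z}(\mathbb{S})$ over all separable LMPs. The cofinality of a limit ordinal $\lambda$ is the least order type of an unbounded subset of $\lambda$. *)

(* Defs.v *)
From HB Require Import structures.
From mathcomp Require Import all_boot all_order all_algebra.
From mathcomp Require Import all_classical all_reals all_analysis.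
Set Implicit Arguments. Unset Strict Implicit. Unset Printing Implicit Defensive.
Import Order.TTheory GRing.Theory Num.Theory.
Local Open Scope classical_set_scope.
Local Open Scope ring_scope.

(* Ordinals, represented (as usual in type theory) by well-ordered     *)
(* types.  An element w of W stands for the ordinal = order type of    *)
(* the initial segment {v | v < w}; W itself stands for its order type. *)
Record WO := {
  wcar :> Type;
  wlt : wcar -> wcar -> Prop;
  wlt_wf : well_founded wlt;
  wlt_trans : forall x y z, wlt x y -> wlt y z -> wlt x z;
  wlt_total : forall x y, wlt x y \/ x = y \/ wlt y x }.
Arguments wlt {w}.

Definition wo_le (A B : WO) : Prop :=
  exists f : A -> B, forall x y, wlt x y -> wlt (f x) (f y).

Section LMP.
Context {R : realType} {d : measure_display} {T : measurableType d}
  {L : countType} (tau : L -> R.-spker T ~> T).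

Definition separable : Prop :=
  (exists G : nat -> set T, (forall n, measurable (G n)) /\
     (forall A : set T, measurable A <-> <<s range G >> A)) /\
  (forall x y : T, x <> y -> exists A : set T, measurable A /\ A x /\ ~ A y).

Definition rclosed (Rel : T -> T -> Prop) (A : set T) : Prop :=
  forall x s, A x -> Rel x s -> A s.

Definition SigmaR (Rel : T -> T -> Prop) : set (set T) :=
  [set A | measurable A /\ rclosed Rel A].

Definition Rset (Gamma : set (set T)) : T -> T -> Prop :=
  fun s t => forall A, Gamma A -> (A s <-> A t).

Definition RT (Lambda : set (set T)) : T -> T -> Prop :=
  fun s t => forall a E, Lambda E -> tau a s E = tau a t E.

Definition Oop (Rel : T -> T -> Prop) : T -> T -> Prop := RT (SigmaR Rel).

Inductive formula :=
| FTop
| FAnd of formula & formula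
| FDiam of L & rat & formula.

Fixpoint wf_formula (phi : formula) : Prop :=
  match phi with
  | FTop => True
  | FAnd p q => wf_formula p /\ wf_formula q
  | FDiam _ q p => (0 <= q <= 1)%R /\ wf_formula p
  end.

Fixpoint den (phi : formula) : set T :=
  match phi with
  | FTop => setT
  | FAnd p q => den p `&` den q
  | FDiam a q p => [set s | ((ratr q)%:E < tau a s (den p))%E]
  end.

Definition denL : set (set T) := [set den phi | phi in wf_formula].
Definition sim_e : T -> T -> Prop := Rset (<<s denL >>).

Definition state_bisim (Rel : T -> T -> Prop) : Prop :=
  (forall s t, Rel s t -> Rel t s) /\
  (forall s t, Rel s t -> forall C, SigmaR Rel C -> forall a, tau a s C = tau a t C).
Definition sim_s : T -> T -> Prop :=
  fun s t => exists Rel, state_bisim Rel /\ Rel s t.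

(* Transfinite iteration of O along a well-order.  [stage below F R0 X]
   says that X is the value of the iteration at the ordinal whose
   predecessors are the elements v with [below v] (F v being O^v(R0)):
   R0 at 0, O(F p) at a successor p+1, the intersection at limits. *)
Definition stage (W : WO) (below : W -> Prop) (F : W -> T -> T -> Prop)
  (R0 X : T -> T -> Prop) : Prop :=
  ((forall v, ~ below v) -> forall s t, X s t <-> R0 s t) /\
  (forall p, below p -> (forall v, below v -> v = p \/ wlt v p) ->
     forall s t, X s t <-> Oop (F p) s t) /\
  ((exists v, below v) -> (forall p, below p -> exists v, below v /\ wlt p v) ->
     forall s t, X s t <-> (forall v, below v -> F v s t)).

Definition is_iter (W : WO) (R0 : T -> T -> Prop) (F : W -> T -> T -> Prop) :=
  forall w, stage (fun v => wlt v w) F R0 (F w).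

(* The Zhou ordinal of the LMP is (the order type of) W:
   O^W(sim_e) = sim_s and O^w(sim_e) <> sim_s for every w < W. *)
Definition zhou (W : WO) : Prop :=
  exists F : W -> T -> T -> Prop, is_iter sim_e F /\ stage (fun _ => True) F sim_e sim_s /\
    forall w, ~ (forall s t, F w s t <-> sim_s s t).
End LMP.

Definition upper_bound_zhou (R : realType) (K : WO) : Prop :=
  forall (d : measure_display) (T : measurableType d) (L : countType)
    (tau : L -> R.-spker T ~> T) (W : WO),
    @separable _ T -> zhou tau W -> wo_le W K.

Definition is_sup_zhou (R : realType) (K : WO) : Prop :=
  upper_bound_zhou R K /\ forall K', upper_bound_zhou R K' -> wo_le K K'.

Definition wo_limit (K : WO) : Prop :=
  (exists k : K, True) /\ forall k : K, exists k' : K, wlt k k'.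

(* cf(K) > omega: every unbounded subset of K has order type > omega,
   i.e. does not embed order-preservingly into nat. *)
Definition cof_gt_omega (K : WO) : Prop :=
  forall X : set K,
    (forall b : K, exists x, X x /\ (b = x \/ wlt b x)) ->
    ~ exists g : K -> nat, forall x y, X x -> X y -> wlt x y -> (g x < g y)%N.

(* K >= omega_1, i.e. K is uncountable *)
Definition wo_uncountable (K : WO) : Prop :=
  ~ exists f : nat -> K, forall k : K, exists n, f n = k.

(* Main.v *)
Require Import Defs.
From HB Require Import structures.
From mathcomp Require Import all_boot all_order all_algebra.
From mathcomp Require Import all_classical all_reals all_analysis.
From mathcomp Require Import measurable_realfun wochoice ring lra.
Set Implicit Arguments. Unset Strict Implicit. Unset Printing Implicit Defensive.
Import Order.TTheory GRing.Theory Num.Theory.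
Import numFieldNormedType.Exports.
Local Open Scope classical_set_scope.
Local Open Scope ring_scope.

(** Fix a well-order B too long to inject into pairs of sets of naturals, and
    iterate O along B on every separable process. Since each stage at which the
    iteration is not yet state bisimilarity loses a pair of states, it stabilises
    inside B, and the supremum K of the Zhou ordinals is the set of those b in B
    that are unstable stages of some separable process.

    Everything then follows from one construction. Given separable processes S_n
    with pairs of states s_n, t_n that are not state bisimilar, glue to their sum a
    space C and two roots. A point x of C moves, on the k-th of countably many
    labels, to s_k or t_k according to whether x lies in G_k, where the G_k
    separate the points of C. The roots throw onto C two measures that agree on
    the sigma-algebra generated by the G_k but differ on some measurable set V. The
    roots are not state bisimilar, since state bisimilarity separates all points
    of C and so V is closed. They do survive stage v+1 as soon as (s_n, t_n)
    survives stage v for all but finitely many n, because then a closed set at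
    stage v meets C in a set determined by finitely many of the G_k. Hence, if a
    sequence in K eventually dominated every element of K, choosing S_n accordingly
    would produce a process stabilising only beyond K.

    C is the real line with the Borel sets and one extra set V, for which the
    translation by each 3^-n exchanges V and its complement; the two measures are
    the traces of Lebesgue outer measure on V and on its complement. *)

(** * Well-orders *)

Lemma wlt_irrefl (W : WO) (x : W) : ~ wlt x x.
Proof.
by elim/(well_founded_ind (@wlt_wf W)): x => x IH xx; exact: (IH x).
Qed.

Lemma nwlt_trans (W : WO) (x y z : W) : ~ wlt x y -> ~ wlt y z -> ~ wlt x z.
Proof.
move=> xy yz xz; have [yx|[yx|//]] := wlt_total y x; apply: yz.
  exact: wlt_trans yx xz.
by rewrite yx.
Qed.

Lemma wo_max (W : WO) (x y : W) : exists z : W, [/\ z = x \/ z = y, ~ wlt z x & ~ wlt z y].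
Proof.
have [xy|[->|yx]] := wlt_total x y.
- exists y; split; [by right| |exact: wlt_irrefl].
  by move=> yx; exact: (wlt_irrefl (wlt_trans xy yx)).
- by exists y; split; [right|exact: wlt_irrefl|exact: wlt_irrefl].
- exists x; split; [by left|exact: wlt_irrefl|].
  by move=> xy; exact: (wlt_irrefl (wlt_trans xy yx)).
Qed.

Lemma wlt_least (W : WO) (P : W -> Prop) : (exists x, P x) ->
  exists x, P x /\ forall y, P y -> ~ wlt y x.
Proof.
case=> x; elim/(well_founded_ind (@wlt_wf W)): x => x IH Px.
have [[y [yx Py]]|nex] := pselect (exists y, wlt y x /\ P y); first exact: IH Py.
by exists x; split=> // y Py yx; apply: nex; exists y.
Qed.

Lemma well_orderable (X : Type) : exists lt : X -> X -> Prop,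
  [/\ well_founded lt, forall x y z, lt x y -> lt y z -> lt x z &
      forall x y, lt x y \/ x = y \/ lt y x].
Proof.
have [r wor] := well_ordering_principle {classic X}.
have woT : wo_chain r predT by move=> A _; exact: wor.
have anti x y : r x y -> r y x -> x = y.
  by move=> xy yx; apply: (wo_chain_antisymmetric woT) => //; rewrite xy yx.
have tot x y : r x y \/ r y x.
  exact/orP/(wo_chainW woT).
have minP (P : X -> Prop) : (exists x, P x) -> exists2 z, P z & forall y, P y -> r z y.
  move=> [x Px]; have [|z [[zP zlb] _]] := wor [pred y | `[< P y >]].
    by exists x; apply/asboolP.
  exists z; first exact/asboolP.
  by move=> y Py; apply: zlb; apply/asboolP.
have trans x y z : r x y -> r y z -> r x z.
  (* Transitivity comes from the least of the three elements: if it is x the claim is immediate,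
     otherwise antisymmetry identifies two neighbours. *)
  move=> xy yz; have [|m Pm lb] := minP (fun u => [\/ u = x, u = y | u = z]).
    by exists x; constructor 1.
  have mx := lb x (Or31 _ _ erefl); have my := lb y (Or32 _ _ erefl).
  have mz := lb z (Or33 _ _ erefl).
  case: Pm => mE; rewrite mE in mx my mz => //.
    by rewrite (anti _ _ xy mx).
  by rewrite -(anti _ _ yz my).
exists (fun x y => r x y /\ x <> y); split.
- move=> x; apply: contrapT => nx.
  have [|z nz lb] := minP (fun u => ~ Acc (fun x y => r x y /\ x <> y) u).
    by exists x.
  apply: nz; constructor => y [yz neq]; apply: contrapT => ny.
  by apply: neq; apply: anti => //; exact: lb.
- move=> x y z [xy nxy] [yz nyz]; split; first exact: trans yz.
  by move=> xz; apply: nxy; apply: anti => //; rewrite xz.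
- move=> x y; have [->|nxy] := pselect (x = y); first by right; left.
  have [xy|yx] := tot x y; first by left.
  by right; right; split=> // E; apply: nxy.
Qed.

Section SubWO.
Variables (W : WO) (P : W -> Prop).
Let lt (x y : {x : W | P x}) := wlt (sval x) (sval y).

Let lt_wf : well_founded lt.
Proof.
move=> [x Px]; elim/(well_founded_ind (@wlt_wf W)): x Px => x IH Px.
by constructor => -[y Py] yx; exact: IH.
Qed.

Let lt_trans x y z : lt x y -> lt y z -> lt x z.
Proof. exact: wlt_trans. Qed.

Let lt_total x y : lt x y \/ x = y \/ lt y x.
Proof.
have [|[|]] := wlt_total (sval x) (sval y); [by left| |by right; right].
by move=> xy; right; left; exact: eq_sig_hprop xy.
Qed.

Definition wo_sub : WO := Build_WO lt_wf lt_trans lt_total.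
End SubWO.

Lemma wo_le_trans (A B C : WO) : wo_le A B -> wo_le B C -> wo_le A C.
Proof.
by move=> [f fP] [g gP]; exists (g \o f) => x y xy; apply: gP; exact: fP.
Qed.

Lemma wo_le_sub (W : WO) (P Q : W -> Prop) : (forall x, P x -> Q x) ->
  wo_le (wo_sub P) (wo_sub Q).
Proof. by move=> PQ; exists (fun x => exist _ (sval x) (PQ _ (svalP x))). Qed.

(** * Iterating O *)

Section Iteration.
Context {R : realType} {d : measure_display} {T : measurableType d}
  {L : countType} (tau : L -> R.-spker T ~> T).
Implicit Types (Rel : T -> T -> Prop) (W : WO).

Lemma Oop_mono Rel1 Rel2 : (forall s t, Rel1 s t -> Rel2 s t) ->
  forall s t, Oop tau Rel1 s t -> Oop tau Rel2 s t.
Proof.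
move=> sub s t st a E [mE cE]; apply: st; split=> // x y Ex /sub; exact: cE.
Qed.

Lemma SigmaR_setT Rel : SigmaR Rel setT.
Proof. by split; first exact: measurableT. Qed.

Lemma Oop_sym Rel s t : Oop tau Rel s t -> Oop tau Rel t s.
Proof. by move=> st a E /(st a). Qed.

Lemma Rset_sigma (G : set (set T)) s t : Rset G s t -> Rset <<s G >> s t.
Proof.
move=> st A; move: A.
apply: (@smallest_sub _ _ G [set A : set T | A s <-> A t]); last first.
  by move=> A GA; exact: st.
split=> /= [//|A AE|F FE]; first by split=> -[_ nA]; split=> // /AE.
by split=> -[i _ Fi]; exists i => //; exact/FE.
Qed.

Lemma sim_eP s t :
  sim_e tau s t <-> forall phi, wf_formula phi -> (den tau phi s <-> den tau phi t).
Proof.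
split=> [st phi wphi|st]; first by apply: st; apply: sub_sigma_algebra; exists phi.
by apply: Rset_sigma => _ [phi wphi <-]; exact: st.
Qed.

Lemma sim_e_sym s t : sim_e tau s t -> sim_e tau t s.
Proof. by move=> st A GA; apply: iff_sym; exact: st. Qed.

Lemma measurable_den phi : measurable (den tau phi).
Proof.
elim: phi => [|p mp q mq|a q p mp] /=; [exact: measurableT|exact: measurableI|].
rewrite -[X in measurable X]setTI.
exact: emeasurable_fun_o_infty (measurable_kernel (tau a) _ mp) _.
Qed.

(** Denotations of formulas are measurable and closed under any relation inside [sim_e], so two
    states related by O of such a relation agree on every diamond. *)
Lemma Oop_sim_e Rel : (forall s t, Rel s t -> sim_e tau s t) ->
  forall s t, Oop tau Rel s t -> sim_e tau s t.
Proof.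
move=> sub s t st; apply/sim_eP; elim=> [//|p IHp q IHq|a q p _] /=.
  by move=> [/IHp pE /IHq qE]; split=> -[/pE ? /qE].
move=> [_ wp]; rewrite (st a) //; split; first exact: measurable_den.
by move=> x y px xy; exact: ((sim_eP x y).1 (sub _ _ xy) p wp).1.
Qed.

Lemma sim_s_sym s t : sim_s tau s t -> sim_s tau t s.
Proof. by move=> [Rel [bRel st]]; exists Rel; split=> //; exact: bRel.1. Qed.

Lemma sim_s_Oop s t : sim_s tau s t -> Oop tau (sim_s tau) s t.
Proof.
move=> [Rel [bRel st]] a E [mE cE]; apply: (bRel.2 _ _ st); split=> //.
by move=> x y Ex xy; apply: cE Ex _; exists Rel.
Qed.

Lemma post_fixpoint_sim_s Rel : (forall s t, Rel s t -> Rel t s) ->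
  (forall s t, Rel s t -> Oop tau Rel s t) ->
  forall s t, Rel s t -> sim_s tau s t.
Proof.
by move=> sym post s t st; exists Rel; split=> //; split=> // u v /post uv C + a; exact: uv.
Qed.

Lemma sim_s_sim_e s t : sim_s tau s t -> sim_e tau s t.
Proof.
move=> st; apply/sim_eP => phi; elim: phi s t st => [//|p IHp q IHq|a q p IHp] s t st /=.
  by move=> [/(IHp _ _ st) pE /(IHq _ _ st) qE]; split=> -[/pE ? /qE].
move=> [_ wp]; rewrite (sim_s_Oop st a) //; split; first exact: measurable_den.
by move=> x y px xy; exact: (IHp x y xy wp).1.
Qed.

(* Since O is monotone and O(sim_e) is included in sim_e, the zero, successor
   and limit clauses collapse into one formula. *)
Definition uniform_iter W (F : W -> T -> T -> Prop) :=
  forall w s t, F w s t <-> sim_e tau s t /\ forall v, wlt v w -> Oop tau (F v) s t.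

(** For a down-closed [below] one of the three clauses of [stage] always applies and determines X,
    and the uniform formula satisfies all three. Keeping [below] abstract covers both a single stage
    w and the final stage W; the formula for F is assumed only below, as needed for induction along
    W. *)
Lemma uniform_stage W (below : W -> Prop) (F : W -> T -> T -> Prop) X :
  (forall v w, wlt v w -> below w -> below v) ->
  (forall w, below w ->
    forall s t, F w s t <-> sim_e tau s t /\ forall v, wlt v w -> Oop tau (F v) s t) ->
  stage tau below F (sim_e tau) X <->
  (forall s t, X s t <-> sim_e tau s t /\ forall v, below v -> Oop tau (F v) s t).
Proof.
move=> down uF.
pose U s t := sim_e tau s t /\ forall v, below v -> Oop tau (F v) s t.
have Fe v s t : below v -> F v s t -> sim_e tau s t by move=> bv /(uF _ bv)[].
have FO v w s t : below w -> wlt v w -> F w s t -> Oop tau (F v) s t.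
  by move=> bw vw /(uF _ bw)[_]; apply.
have Fm v w s t : below w -> wlt v w -> F w s t -> F v s t.
  move=> bw vw /(uF _ bw)[st vP]; apply/(uF _ (down _ _ vw bw)); split=> // u uv.
  by apply: vP; exact: wlt_trans uv vw.
have stU : stage tau below F (sim_e tau) U.
  split; last split.
  - by move=> nb s t; split=> [[]//|st]; split=> // v /nb.
  - move=> p bp pmax s t; split=> [[_]|st]; first exact.
    split; first by apply: Oop_sim_e st => u v; exact: Fe.
    move=> v bv; case: (pmax v bv) => [->//|vp].
    by apply: Oop_mono st => x y; exact: Fm.
  - move=> [v0 bv0] lim s t; split=> [[st vP] v bv|st].
      by apply/(uF _ bv); split=> // u uv; apply: vP; exact: down uv bv.
    split=> [|v bv]; first by apply: Fe (st _ bv0).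
    by have [w [bw vw]] := lim _ bv; apply: FO vw (st _ bw).
split=> [stX s t|XE].
  have [[v bv]|nb] := pselect (exists v, below v); last first.
    have nb' v : ~ below v by move=> bv; apply: nb; exists v.
    exact: iff_trans (stX.1 nb' s t) (iff_sym (stU.1 nb' s t)).
  have [[p [bp pmax]]|nmax] :=
      pselect (exists p, below p /\ forall v, below v -> v = p \/ wlt v p).
    exact: iff_trans (stX.2.1 p bp pmax s t) (iff_sym (stU.2.1 p bp pmax s t)).
  have lim p : below p -> exists v, below v /\ wlt p v.
    move=> bp; apply: contrapT => np; apply: nmax; exists p; split=> // u bu.
    have [|[|pu]] := wlt_total u p; [by right|by left|].
    by exfalso; apply: np; exists u.
  have ex : exists v, below v by exists v.
  exact: iff_trans (stX.2.2 ex lim s t) (iff_sym (stU.2.2 ex lim s t)).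
case: stU => [U1 [U2 U3]]; split; last split.
- by move=> nb s t; exact: iff_trans (XE s t) (U1 nb s t).
- by move=> p bp pm s t; exact: iff_trans (XE s t) (U2 p bp pm s t).
- by move=> ex lim s t; exact: iff_trans (XE s t) (U3 ex lim s t).
Qed.

Lemma is_iter_uniform W (F : W -> T -> T -> Prop) :
  is_iter tau (sim_e tau) F <-> uniform_iter F.
Proof.
have down (w u v : W) : wlt u v -> wlt v w -> wlt u w by exact: wlt_trans.
split=> uF w; last first.
  by apply: (uniform_stage (F w) (@down w) _).2 => // v _; exact: uF.
elim/(well_founded_ind (@wlt_wf W)): w => w IH.
exact: (uniform_stage (F w) (@down w) IH).1 (uF w).
Qed.

Definition iterO W : W -> T -> T -> Prop :=
  Fix (@wlt_wf W) (fun=> T -> T -> Prop)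
    (fun w rec s t => sim_e tau s t /\ forall v (vw : wlt v w), Oop tau (rec v vw) s t).

Lemma iterOP W : uniform_iter (@iterO W).
Proof.
move=> w s t; rewrite /iterO Fix_eq //= => x f g fg.
suff -> : f = g by [].
by do 2 apply: functional_extensionality_dep => ?; exact: fg.
Qed.

Section Uniform.
Variables (W : WO) (F : W -> T -> T -> Prop).
Hypothesis uF : uniform_iter F.

Lemma uniform_sim_e w s t : F w s t -> sim_e tau s t.
Proof. by move/uF => []. Qed.

Lemma uniform_Oop v w s t : wlt v w -> F w s t -> Oop tau (F v) s t.
Proof. by move=> vw /uF[_]; apply. Qed.

Lemma uniform_decr v w s t : wlt v w -> F w s t -> F v s t.
Proof.
move=> vw /uF[st wP]; apply/uF; split=> // u uv; apply: wP.
exact: wlt_trans uv vw.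
Qed.

Lemma uniform_sym w s t : F w s t -> F w t s.
Proof.
move=> /uF[st wP]; apply/uF; split; first exact: sim_e_sym.
by move=> v /wP; exact: Oop_sym.
Qed.

Lemma sim_s_uniform w s t : sim_s tau s t -> F w s t.
Proof.
elim/(well_founded_ind (@wlt_wf W)): w s t => w IH s t st; apply/uF; split.
  exact: sim_s_sim_e.
by move=> v vw; apply: (Oop_mono (IH v vw)); exact: sim_s_Oop.
Qed.

Lemma uniform_fix w : (forall s t, F w s t -> Oop tau (F w) s t) ->
  forall s t, F w s t -> sim_s tau s t.
Proof. by apply: post_fixpoint_sim_s; exact: uniform_sym. Qed.

End Uniform.

Definition unstable W (b : W) := exists s t, iterO b s t /\ ~ sim_s tau s t.

Lemma unstable_down W (b c : W) : wlt b c -> unstable c -> unstable b.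
Proof.
move=> bc [s [t [st nst]]]; exists s, t; split=> //.
exact: (uniform_decr (@iterOP W)) bc st.
Qed.

Lemma stableP W (b : W) : ~ unstable b <-> forall s t, iterO b s t -> sim_s tau s t.
Proof.
split=> [nb s t st|nb [s [t [/nb]]]//].
by apply: contrapT => nst; apply: nb; exists s, t.
Qed.

Lemma zhou_uniform W : zhou tau W <-> exists F : W -> T -> T -> Prop,
  [/\ uniform_iter F,
      forall s t, sim_s tau s t <-> sim_e tau s t /\ forall w, Oop tau (F w) s t &
      forall w, ~ (forall s t, F w s t <-> sim_s tau s t)].
Proof.
have stageT F : uniform_iter F -> stage tau (fun _ : W => True) F (sim_e tau) (sim_s tau) <->
    forall s t, sim_s tau s t <-> sim_e tau s t /\ forall w, Oop tau (F w) s t.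
  move=> uF; have := @uniform_stage W (fun=> True) F (sim_s tau) (fun _ _ _ => id)
    (fun w _ => uF w).
  move=> H; apply: (iff_trans H); split=> E s t; apply: (iff_trans (E s t)).
    by split=> -[st wP]; split=> // w; apply: wP.
  by split=> -[st wP]; split=> // w; apply: wP.
split=> [[F [/is_iter_uniform uF [sF nF]]]|[F [uF sF nF]]]; exists F.
  by split=> //; exact/stageT.
by split; [exact/is_iter_uniform|split=> //; exact/stageT].
Qed.

(** The unstable elements are exactly those below the least stable one, and the iteration along B,
    cut off there, first meets [sim_s] at the end of the segment. *)
Lemma zhou_unstable W : (exists b : W, ~ unstable b) -> zhou tau (wo_sub (@unstable W)).
Proof.
move=> /wlt_least[b [/stableP stb bmin]].
apply/zhou_uniform; exists (fun w => iterO (sval w)); split.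
- move=> [w uw] s t /=; split.
    move=> /iterOP[st wP]; split=> // -[v uv] /= vw; exact: wP.
  move=> [st wP]; apply/iterOP; split=> // v vw.
  exact: (wP (exist _ v (unstable_down vw uw))).
- move=> s t; split=> [st|[st wP]].
    split; first exact: sim_s_sim_e.
    move=> w; apply: Oop_mono (sim_s_Oop st) => x y.
    exact: (sim_s_uniform (@iterOP W)).
  apply: stb; apply/iterOP; split=> // v vb.
  have uv : unstable v by apply: contrapT => /bmin.
  exact: (wP (exist _ v uv)).
- by move=> [w [s [t [st nst]]]] /= /(_ s t)[+ _]; move=> /(_ st).
Qed.

(** Each stage of the given iteration F is, as a relation, some stage of the iteration along B.
    Before stabilisation the stages strictly decrease, so this matching is strictly monotone. *)
Lemma zhou_wo_le W (B : WO) : (exists b : B, ~ unstable b) -> zhou tau W ->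
  wo_le W (wo_sub (@unstable B)).
Proof.
move=> [b0 /stableP sb0] /zhou_uniform[F [uF _ nF]].
have FS w : exists s t, F w s t /\ ~ sim_s tau s t.
  apply: contrapT => nex; apply: (nF w) => s t; split; last exact: sim_s_uniform.
  by move=> st; apply: contrapT => nst; apply: nex; exists s, t.
have main w : exists b : B, forall s t, F w s t <-> iterO b s t.
  elim/(well_founded_ind (@wlt_wf W)): w => w IH.
  (* The matching stage is the least b whose relation lies inside [F w]; the stable stage [b0] is a
     candidate because [sim_s] lies inside every stage. *)
  have [|b [bP bmin]] := @wlt_least B (fun b => forall s t, iterO b s t -> F w s t).
    by exists b0 => s t /sb0; exact: sim_s_uniform.
  exists b => s t; split=> [st|]; last exact: bP.
  apply/iterOP; split; first exact: uniform_sim_e st.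
  move=> c cb.
  (* Since c is below the least b, some pair of stage c is rejected by O of an earlier [F v], which
     is a stage e of B. Were e below c, that pair would have passed; hence c is at most e and [F v]
     lies inside stage c. *)
  have [x [y [xy nxy]]] : exists x y, iterO c x y /\ ~ F w x y.
    apply: contrapT => nex; apply: (bmin c) => // x y xy.
    by apply: contrapT => nxy; apply: nex; exists x, y.
  have [v [vw nv]] : exists v, wlt v w /\ ~ Oop tau (F v) x y.
    apply: contrapT => nex; apply: nxy; apply/uF; split.
      exact: (uniform_sim_e (@iterOP B)) xy.
    by move=> v vw; apply: contrapT => nv; apply: nex; exists v.
  have [e eP] := IH v vw.
  have stv := uniform_Oop uF vw st.
  have nec : ~ wlt e c.
    move=> ec; apply: nv; apply: Oop_mono (uniform_Oop (@iterOP B) ec xy) => u u'.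
    by move/eP.
  apply: Oop_mono stv => u u' /eP ee.
  have [//|[<-//|ce]] := wlt_total e c.
  exact: (uniform_decr (@iterOP B)) ce ee.
have [f fP] := choice main.
have fu w : unstable (f w).
  by have [s [t [st nst]]] := FS w; exists s, t; split=> //; apply/fP.
exists (fun w => exist _ (f w) (fu w)) => v w vw.
(* If the matching failed to increase, [F v] would lie inside [F w], hence inside O of itself, and
   would already be contained in [sim_s]. *)
have [//|fwv] : wlt (f v) (f w) \/ (forall s t, iterO (f v) s t -> iterO (f w) s t).
  have [|[->|wv]] := wlt_total (f v) (f w); [by left|by right|right].
  by move=> s t; exact: (uniform_decr (@iterOP B)).
have [s [t [st nst]]] := FS v; case: nst.
apply: (uniform_fix uF) st => x y /fP /fwv /fP; exact: uniform_Oop.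
Qed.

End Iteration.

(** A point is coded by the indices of the generators containing it; equal codes force membership in
    the same measurable sets. *)
Lemma separable_injection (d : measure_display) (T : measurableType d) :
  @separable d T -> exists f : T -> set nat, injective f.
Proof.
move=> [[G [mG GE]] sep]; exists (fun x => [set n | G n x]) => x y xy.
apply: contrapT => /sep[A [/GE sA [Ax nAy]]]; apply: nAy.
apply: (Rset_sigma _ sA).1 Ax => _ [n _ <-].
by have /= -> : [set n | G n x] n = [set n | G n y] n by rewrite xy.
Qed.

(** The power set of the codes for pairs of states: by Cantor it does not inject into those
    pairs. *)
Definition codes := set (set nat * set nat).

Lemma cantor_injection (X : Type) (g : set X -> X) : ~ injective g.
Proof.
move=> gI; pose D := [set x | exists A, g A = x /\ ~ A x].
have nD : ~ D (g D) by move=> DD; have [A [/gI-> ]] := DD; apply.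
by apply: (nD); exists D.
Qed.

(* Every well-order of [codes] is longer than the iteration on any separable
   process, because each unstable stage loses a pair of states that no other
   stage loses. *)
Lemma separable_stable (R : realType) (d : measure_display) (T : measurableType d)
    (L : countType) (tau : L -> R.-spker T ~> T) (B : WO) (g : codes -> B) :
  injective g -> @separable d T -> exists b : B, ~ unstable tau b.
Proof.
move=> gI /separable_injection[f fI]; apply: contrapT => all_unst.
have lose (b : B) : exists p : T * T,
    iterO tau b p.1 p.2 /\ ~ Oop tau (iterO tau b) p.1 p.2.
  apply: contrapT => np; apply: all_unst; exists b; apply/stableP.
  apply: (uniform_fix (@iterOP _ _ _ _ tau B)) => s t st.
  by apply: contrapT => nst; apply: np; exists (s, t).
have [h hP] := choice lose.
have hI : injective h.
  have lt b c : wlt b c -> h b <> h c.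
    move=> bc hbc; have [_] := hP b; apply; rewrite hbc.
    exact: (uniform_Oop (@iterOP _ _ _ _ tau B)) bc (hP c).1.
  move=> b c hbc; have [/lt/(_ hbc)//|[//|/lt/(_ (esym hbc))//]] := wlt_total b c.
apply: (@cantor_injection _ (fun A : codes => (f (h (g A)).1, f (h (g A)).2))).
by move=> A A' [/fI h1 /fI h2]; apply/gI/hI; rewrite [LHS]surjective_pairing h1 h2 -surjective_pairing.
Qed.

(** * The supremum of the Zhou ordinals *)

Section Sup.
Variable R : realType.
Variable B : WO.
Variable g : codes -> B.
Hypothesis gI : injective g.

Definition zhou_reached (b : B) := exists (d : measure_display) (T : measurableType d)
  (L : countType) (tau : L -> R.-spker T ~> T), @separable d T /\ unstable tau b.

Lemma is_sup_zhou_reached : is_sup_zhou R (wo_sub zhou_reached).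
Proof.
split=> [d T L tau W sep zW|K' ubK'].
  apply: wo_le_trans (zhou_wo_le (separable_stable tau gI sep) zW) _.
  by apply: wo_le_sub => b ub; exists d, T, L, tau.
(* Embeddings coming from different processes need not agree, so k goes to the least value it takes
   under any embedding of an initial segment into [K']. A segment attaining that value also contains
   every j below k and sends it strictly lower. *)
pose img (k : B) (k' : K') := exists (Q : B -> Prop) (Qk : Q k) (e : wo_sub Q -> K'),
  [/\ forall x y, wlt x y -> Q y -> Q x, forall x y, wlt x y -> wlt (e x) (e y) &
      e (exist _ k Qk) = k'].
have ex (k : wo_sub zhou_reached) :
    exists k', img (sval k) k' /\ forall y, img (sval k) y -> ~ wlt y k'.
  apply: wlt_least; case: k => k [d [T [L [tau [sep uk]]]]] /=.
  have [e eP] := ubK' _ _ _ tau _ sep (zhou_unstable (separable_stable tau gI sep)).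
  exists (e (exist _ k uk)), (@unstable _ _ _ _ tau B), uk, e; split=> // x y.
  exact: unstable_down.
have [f fP] := choice ex.
exists f => j k jk; have [[Q [Qk [e [down emono ek]]]] _] := fP k.
have Qj := down _ _ jk Qk.
have ej : img (sval j) (e (exist _ (sval j) Qj)) by exists Q, Qj, e.
have ejk : wlt (e (exist _ (sval j) Qj)) (f k) by rewrite -ek; exact: emono.
have nej := (fP j).2 _ ej.
have [fje|[->//|//]] := wlt_total (f j) (e (exist _ (sval j) Qj)).
exact: wlt_trans fje ejk.
Qed.

End Sup.

(** * Two measures agreeing on a separating sequence *)

Section OuterTrace.
Context {R : realType} {T : Type}.
Variables (mu : {outer_measure set T -> \bar R}) (D : set T).

Definition outer_trace (A : set T) : \bar R := mu (A `&` D).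

Let outer_trace0 : outer_trace set0 = 0%E.
Proof. by rewrite /outer_trace set0I outer_measure0. Qed.

Let outer_trace_ge0 A : (0 <= outer_trace A)%E.
Proof. exact: outer_measure_ge0. Qed.

Let le_outer_trace : {homo outer_trace : A B / A `<=` B >-> (A <= B)%E}.
Proof. by move=> A B AB; apply: le_outer_measure; exact: setSI. Qed.

Let outer_trace_sigma_subadditive : sigma_subadditive outer_trace.
Proof.
by move=> F; rewrite /outer_trace setI_bigcupl; exact: outer_measure_sigma_subadditive.
Qed.

HB.instance Definition _ := isOuterMeasure.Build R T outer_trace outer_trace0
  outer_trace_ge0 le_outer_trace outer_trace_sigma_subadditive.

Lemma caratheodory_outer_trace A : mu.-caratheodory A -> outer_trace.-caratheodory A.
Proof. by move=> cA X; rewrite /outer_trace (cA (X `&` D)) (setIAC X D A) (setIAC X D (~` A)). Qed.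

(** The complement of a superset of D has trace zero. This lets the parity set and its complement
    become measurable for the traces. *)
Lemma caratheodory_outer_trace_sup A : D `<=` A -> outer_trace.-caratheodory A.
Proof.
move=> DA X; rewrite /outer_trace -!setIA (setIidr DA).
have -> : ~` A `&` D = set0 by apply/seteqP; split=> // x [nA /DA].
by rewrite setI0 outer_measure0 adde0.
Qed.

End OuterTrace.

Section CaratheodoryRestriction.
Context {R : realType} {T : pointedType}.
Variables (mu : {outer_measure set T -> \bar R}) (H : set (set T)).
Hypothesis HC : H `<=` mu.-caratheodory.

(** The inclusion is an argument so that the measure structure, which depends on it, can be attached
    to this function. *)
Definition cara_restr (_ : H `<=` mu.-caratheodory) :
  set (g_sigma_algebraType H) -> \bar R := mu.

Let sub : <<s H >> `<=` mu.-cara.-measurable.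
Proof.
apply: smallest_sub => //; split; first exact: measurable0.
- by move=> A mA; rewrite setTD; exact: measurableC.
- by move=> F mF; exact: bigcupT_measurable.
Qed.

Let cara_restr0 : cara_restr HC set0 = 0%E.
Proof. exact: outer_measure0. Qed.

Let cara_restr_ge0 A : (0 <= cara_restr HC A)%E.
Proof. exact: outer_measure_ge0. Qed.

Let cara_restr_additive : semi_sigma_additive (cara_restr HC).
Proof.
move=> F mF tF mUF; apply: (@caratheodory_measure_sigma_additive _ _ mu) => //.
  by move=> i; apply: sub; exact: mF.
exact: sub.
Qed.

HB.instance Definition _ := isMeasure.Build _ _ R (cara_restr HC)
  cara_restr0 cara_restr_ge0 cara_restr_additive.

End CaratheodoryRestriction.

(** * A Vitali-style partition of the line by parity *)

Section TriadicParity.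
Context {R : realType}.
Implicit Types x y z : R.

(* x - y = k / 3^n with k of parity b. Parity is well defined on Z[1/3]
   because multiplying k by 3 preserves it. *)
Definition triadic (b : bool) x y := exists n i j : nat,
  odd (i + j) = b /\ x * 3 ^+ n + i%:R = y * 3 ^+ n + j%:R.

Lemma triadic_refl x : triadic false x x.
Proof. by exists 0%N, 0%N, 0%N. Qed.

Lemma triadic_sym b x y : triadic b x y -> triadic b y x.
Proof. by move=> [n [i [j [<- E]]]]; exists n, j, i; rewrite addnC. Qed.

Lemma triadic_trans b c x y z :
  triadic b x y -> triadic c y z -> triadic (b (+) c) x z.
Proof.
move=> [n [i [j [<- E]]]] [m [k [l [<- F]]]].
exists (n + m)%N, (i * 3 ^ m + k * 3 ^ n)%N, (j * 3 ^ m + l * 3 ^ n)%N; split.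
  by rewrite !oddD !oddM !oddX/= !orbT !andbT; case: (odd i); case: (odd j);
     case: (odd k); case: (odd l).
rewrite !natrD !natrM !natrX exprD.
have -> : x * (3 ^+ n * 3 ^+ m) + (i%:R * 3 ^+ m + k%:R * 3 ^+ n) =
  (x * 3 ^+ n + i%:R) * 3 ^+ m + k%:R * 3 ^+ n :> R by ring.
rewrite E.
have -> : (y * 3 ^+ n + j%:R) * 3 ^+ m + k%:R * 3 ^+ n =
  (y * 3 ^+ m + k%:R) * 3 ^+ n + j%:R * 3 ^+ m :> R by ring.
by rewrite F; ring.
Qed.

Lemma triadic_inj b c x y : triadic b x y -> triadic c x y -> b = c.
Proof.
move=> xy /triadic_sym /(triadic_trans xy)[n [i [j [ij /addrI/eqP]]]].
rewrite eqr_nat => /eqP E; move: ij; rewrite E addnn odd_double.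
by case: b c {xy} => -[].
Qed.

Lemma triadic_step x n : triadic true x (x - 3 ^- n).
Proof.
exists n, 0%N, 1%N; split=> //; rewrite mulrBl mulVf ?addr0 ?subrK //.
Qed.

(** A chosen representative of the coset of x modulo Z[1/3]. It depends on the coset alone, and the
    default 0 never arises because x lies in its own coset. *)
Definition triadic_rep x : R := xget 0 [set y | triadic false x y \/ triadic true x y].

Lemma triadic_repP x : triadic false x (triadic_rep x) \/ triadic true x (triadic_rep x).
Proof.
have : [set y | triadic false x y \/ triadic true x y] x by left; exact: triadic_refl.
exact: xgetI.
Qed.

Lemma triadic_rep_eq b x y : triadic b x y -> triadic_rep x = triadic_rep y.
Proof.
move=> xy; congr (xget _ _); have yx := triadic_sym xy.
by apply/seteqP; split=> z /= [xz|xz]; [have := triadic_trans yx xz|have := triadic_trans yx xz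
  |have := triadic_trans xy xz|have := triadic_trans xy xz];
  clear; case: b => /=; tauto.
Qed.

Definition parity_set b : set R := [set x | triadic b x (triadic_rep x)].

Lemma parity_setN : parity_set true = ~` parity_set false.
Proof.
apply/seteqP; split=> x /=; first by move=> xt xf; have := triadic_inj xt xf.
by case: (triadic_repP x).
Qed.

(** The shift has odd numerator 1, so it keeps the representative and flips the parity. *)
Lemma parity_set_step b x n : parity_set b x -> parity_set (~~ b) (x - 3 ^- n).
Proof.
rewrite /parity_set /= -(triadic_rep_eq (triadic_step x n)) => xb.
by have := triadic_trans (triadic_sym (triadic_step x n)) xb; rewrite addTb.
Qed.

End TriadicParity.

(** * Lebesgue outer measure under small translations *)

Section LebesgueOuter.
Context {R : realType}.
Local Open Scope ereal_scope.

Let lstar : {outer_measure set (ocitv_type R) -> \bar R} := ((@wlength R idfun)^*)%mu.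

Lemma le_outer_translation (A : set R) (t : R) : lstar [set (x + t)%R | x in A] <= lstar A.
Proof.
apply: le_ereal_inf_tmp => _ [F [mF AF] <-].
apply: ereal_inf_lbound; exists (fun k => [set (x + t)%R | x in F k]).
  split=> [k|_ [x /AF[k _ Fkx] <-]]; last by exists k => //; exists x.
  have [[a b] _ <-] := mF k.
  exists (a + t, b + t)%R => //=; apply/seteqP; split=> x /=; rewrite !in_itv/=.
    by move=> /andP[ax xb]; exists (x - t)%R; rewrite ?subrK// in_itv/=; lra.
  by move=> [y]; rewrite in_itv/= => /andP[ay yb] <-; lra.
apply: eq_eseriesr => k _; have [[a b] _ <-] := mF k.
have -> : [set (x + t)%R | x in `]a, b]%classic] = `](a + t)%R, (b + t)%R]%classic.
  apply/seteqP; split=> x /=; rewrite !in_itv/=.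
    by move=> [y]; rewrite in_itv/= => /andP[ay yb] <-; lra.
  by move=> /andP[ax xb]; exists (x - t)%R; rewrite ?subrK// in_itv/=; lra.
rewrite /= !wlength_itv/= !lte_fin ltrD2r; case: ifP => // _.
by rewrite -!EFinB; congr (_%:E); ring.
Qed.

Lemma outer_oc (a b : R) : (a <= b)%R -> lstar `]a, b]%classic = (b - a)%:E.
Proof.
move=> ab; rewrite /lstar/= measurable_mu_extE//=; last exact: is_ocitv.
rewrite wlength_itv/= lte_fin; case: ltP => //= ba.
by rewrite (@le_anti _ R a b) ?subrr// ab.
Qed.

Lemma outer_ray (q : R) : lstar.-caratheodory `]-oo, q]%classic.
Proof. by apply: sub_caratheodory; exact: measurable_itv. Qed.

Lemma pow3_small (e : R) : (0 < e)%R -> exists n, (3 ^- n < e :> R)%R.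
Proof.
move=> e0; pose n := (Num.truncn e^-1).+1; exists n.
have n3 : (n <= 3 ^ n)%N by rewrite ltnW// ltn_expl.
rewrite -[ltRHS]invrK ltf_pV2 ?posrE ?exprn_gt0 ?invr_gt0//.
rewrite (lt_le_trans (truncnS_gt e^-1))// -/n -natrX ler_nat//.
Qed.

(** Shifting left by [3 ^- n] carries D2 into D1 and stays below q. Only points of []0, 3 ^- n]]
    leave the unit interval, and their outer measure is arbitrarily small. *)
Lemma le_outer_step (D1 D2 : set R) (q : R) :
  (forall n x, D2 x -> D1 (x - 3 ^- n)%R) ->
  lstar (`]-oo, q] `&` (`]0%R, 1%R] `&` D2)) <= lstar (`]-oo, q] `&` (`]0%R, 1%R] `&` D1)).
Proof.
move=> step; apply/lee_addgt0Pr => e /pow3_small[n ne].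
set I1 := (X in _ <= lstar X + _); set I2 := (X in lstar X <= _).
have t0 : (0 < 3 ^- n :> R)%R by rewrite invr_gt0 exprn_gt0.
have sub : I2 `<=` [set (x + 3 ^- n)%R | x in I1] `|` `]0%R, (3 ^- n)%R]%classic.
  move=> x [/= xq [x01 /(step n) Dx]]; move: xq x01; rewrite !in_itv/= => xq /andP[x0 x1].
  have [xt|tx] := leP x (3 ^- n); first by right; apply/andP; split.
  left; exists (x - 3 ^- n)%R; last by rewrite subrK.
  by split; [|split] => //=; rewrite in_itv/=; lra.
apply: le_trans (le_outer_measure lstar _ _ sub) _.
apply: le_trans (outer_measureU2 _ _ _) _.
apply: leeD; first exact: le_outer_translation.
by rewrite outer_oc ?subr0 ?lee_fin; exact: ltW.
Qed.

End LebesgueOuter.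

Lemma measures_agreeing_on_generators (R : realType) :
  exists (d : measure_display) (C : measurableType d) (G : nat -> set C)
    (mu : bool -> {measure set C -> \bar R}) (V : set C),
  [/\ @separable d C, forall n, measurable (G n),
      forall x y, (forall n, G n x <-> G n y) -> x = y,
      forall b, (mu b setT <= 1)%E &
      (forall E, <<s range G >> E -> mu true E = mu false E) /\
      measurable V /\ mu true V <> mu false V].
Proof.
pose lstar : {outer_measure set (ocitv_type R) -> \bar R} := ((@wlength R idfun)^*)%mu.
pose P b : set R := parity_set b.
pose D b : set R := `]0%R, 1%R]%classic `&` P b.
(* An enumeration of the rationals; numbers that code no rational give 0. *)
pose q n : rat := odflt 0 (unpickle n).
have qP r : exists n, q n = r by exists (pickle r); rewrite /q pickleK.
pose G n : set R := `]-oo, ratr (q n)]%classic.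
(* The generators of the space C: index 0 holds the extra set V, the rational rays are shifted by
   one. *)
pose H n : set R := if n is n'.+1 then G n' else P true.
pose nu b : {outer_measure set (ocitv_type R) -> \bar R} := outer_trace lstar (D b).
have HC b : range H `<=` (nu b).-caratheodory.
  move=> _ [[|n] _ <-]; last exact/caratheodory_outer_trace/outer_ray.
  case: b; first by apply: caratheodory_outer_trace_sup => x [].
  rewrite /= /P parity_setN.
  rewrite -[_.-caratheodory]/((nu false).-cara.-measurable); apply: measurableC.
  by apply: caratheodory_outer_trace_sup => x [].
pose mu b : {measure set (g_sigma_algebraType (range H)) -> \bar R} := cara_restr (HC b).
have sepG x y : (forall n, G n x <-> G n y) -> x = y.
  move=> xy; apply/eqP; rewrite eq_le; apply/andP; split.
    rewrite leNgt; apply/negP => /rat_in_itvoo[r]; rewrite in_itv/= => /andP[yr rx].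
    have [n nr] := qP r; have : G n x by apply/xy; rewrite /G /= in_itv/= nr ltW.
    by rewrite /G /= in_itv/= nr leNgt rx.
  rewrite leNgt; apply/negP => /rat_in_itvoo[r]; rewrite in_itv/= => /andP[yr rx].
  have [n nr] := qP r; have : G n y by apply/xy; rewrite /G /= in_itv/= nr ltW.
  by rewrite /G /= in_itv/= nr leNgt rx.
have mH n : measurable (H n : set (g_sigma_algebraType (range H))).
  by apply: sub_sigma_algebra; exists n.
have nuG n : nu true (G n) = nu false (G n).
  apply/eqP; rewrite eq_le; apply/andP; split; apply: le_outer_step => k x;
  exact: parity_set_step.
have nuT b : (nu b setT <= 1)%E.
  have -> : 1%E = lstar `]0%R, 1%R]%classic by rewrite (outer_oc ler01) subr0.
  by apply: le_outer_measure => x [_ []].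
have agree E : <<s range G >> E -> mu true E = mu false E.
  (* The rays [G (h k)], with endpoint the integer k, exhaust the line and have finite mass. Rays
     are closed under intersection, so agreement on them extends to the sigma-algebra they
     generate. *)
  have [h hP] := choice (fun k : nat => qP k%:R).
  apply: (@g_sigma_algebra_measure_unique _ R (g_sigma_algebraType (range H)) _ _ (fun k => G (h k))).
  - by move=> _ [n _ <-]; exact: (mH n.+1).
  - by move=> i; exists (h i).
  - apply/seteqP; split=> // x _; exists (Num.truncn `|x|).+1 => //.
    rewrite /G /= in_itv/= hP ratr_nat; apply: le_trans (ler_norm x) _.
    by apply: ltW; exact: truncnS_gt.
  - move=> _ _ [m _ <-] [n _ <-].
    have [mn|nm] := leP (q m) (q n); [exists m|exists n] => //.
      by rewrite setIidl// => x; rewrite /G /= !in_itv/= => /le_trans; apply; rewrite ler_rat.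
    by rewrite setIidr// => x; rewrite /G /= !in_itv/= => /le_trans; apply; rewrite ler_rat ltW.
  - by move=> _ [n _ <-]; exact: nuG.
  - move=> k; apply: (@le_lt_trans _ _ 1%E); last exact: ltry.
    by apply: le_trans (nuT true); apply: le_outer_measure.
exists _, (g_sigma_algebraType (range H)), G, mu, (P true); split=> //.
- split; first by exists H; split.
  move=> x y nxy; have [n nG] : exists n, ~ (G n x <-> G n y).
    apply: contrapT => nex; apply: nxy; apply: sepG => n.
    by apply: contrapT => nn; apply: nex; exists n.
  have [Gx|nGx] := pselect (G n x).
    by exists (G n); split; [exact: (mH n.+1)|split=> // Gy; exact: nG].
  exists (~` G n); split; first by apply: measurableC; exact: (mH n.+1).
  by split=> // nGy; apply: nG; split.
- by move=> n; exact: (mH n.+1).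
split=> //; split; first exact: (mH 0%N).
have muE b A : mu b A = lstar (A `&` D b) by [].
have -> : mu false (P true) = 0%E.
  rewrite muE (_ : _ `&` _ = set0) ?outer_measure0//.
  by apply/seteqP; split=> // x [+ [_ xf]]; rewrite /P parity_setN.
have -> : mu true (P true) = mu true setT.
  by rewrite !muE setTI setIidr// => x [].
(* Equality on V would make the total mass of the trace on V zero, hence also that of the other
   trace, as they agree on the whole space. But the two parts cover the unit interval, of outer
   measure 1. *)
move=> mu0.
have : (lstar `]0%R, 1%R]%classic <= mu true setT + mu false setT)%E.
  rewrite !muE; apply: le_trans (outer_measureU2 _ _ _); apply: le_outer_measure => x x01.
  have [xt|xt] := pselect (P true x); first by left.
  right; split=> //; split=> //; apply: contrapT => xf; apply: xt.
  by rewrite /P parity_setN.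
rewrite (outer_oc ler01) -agree; last exact: (@measurableT _ (g_sigma_algebraType (range G))).
by rewrite mu0 adde0 subr0 lee_fin ler10.
Qed.

(** * Gluing processes *)

Definition push_measure (d d' : measure_display) (T1 : measurableType d)
    (T2 : measurableType d') (R : realType) (m : {measure set T1 -> \bar R})
    (f : T1 -> T2) (mf : measurable_fun setT f) : {measure set T2 -> \bar R}.
Proof. unshelve refine (pushforward m f : {measure set T2 -> \bar R}); exact mf. Defined.

Section GlueSpace.
Variables (d : nat -> measure_display) (T : forall n, measurableType (d n)).
Variables (dC : measure_display) (C : measurableType dC).

Inductive glue := Comp (n : nat) of T n | Digits of C | Root of bool.

HB.instance Definition _ := gen_eqMixin glue.
HB.instance Definition _ := gen_choiceMixin glue.
HB.instance Definition _ := isPointed.Build glue (Root true).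

Definition glue_measurable (A : set glue) :=
  (forall n, measurable (@Comp n @^-1` A)) /\ measurable (Digits @^-1` A).

Let glue_measurable0 : glue_measurable set0.
Proof. by split=> [n|]; rewrite preimage_set0; exact: measurable0. Qed.

Let glue_measurableC A : glue_measurable A -> glue_measurable (~` A).
Proof.
by move=> [mA mC]; split=> [n|]; rewrite preimage_setC; exact: measurableC.
Qed.

Let glue_measurable_bigcup (F : (set glue)^nat) :
  (forall i, glue_measurable (F i)) -> glue_measurable (\bigcup_i F i).
Proof.
move=> mF; split=> [n|]; rewrite preimage_bigcup; apply: bigcupT_measurable => i.
  exact: (mF i).1.
exact: (mF i).2.
Qed.

HB.instance Definition _ := isMeasurable.Build default_measure_display glue
  glue_measurable0 glue_measurableC glue_measurable_bigcup.

Lemma measurable_Comp n : measurable_fun setT (@Comp n).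
Proof. by move=> _ A [mA _]; rewrite setTI; exact: mA. Qed.

Lemma measurable_Digits : measurable_fun setT Digits.
Proof. by move=> _ A [_ mA]; rewrite setTI; exact: mA. Qed.

Lemma measurable_fun_glue (d' : measure_display) (Y : measurableType d') (f : glue -> Y) :
  (forall n, measurable_fun setT (fun x => f (@Comp n x))) ->
  measurable_fun setT (fun x => f (Digits x)) -> measurable_fun setT f.
Proof.
move=> mf mC _ A mA; rewrite setTI; split=> [n|].
  by have := mf n measurableT A mA; rewrite setTI.
by have := mC measurableT A mA; rewrite setTI.
Qed.

Lemma Comp_inj n : injective (@Comp n).
Proof.
(* E equates dependent pairs; proof irrelevance makes its index component reflexivity. *)
move=> x y [E]; have := projT2_eq E.
by rewrite (Prop_irrelevance (projT1_eq E) (erefl n)).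
Qed.

Lemma Digits_inj : injective Digits.
Proof. by move=> x y []. Qed.

Lemma measurable_image_Comp n (A : set (T n)) : measurable A -> measurable (@Comp n @` A).
Proof.
move=> mA; split=> [m|]; last first.
  by rewrite (_ : _ @^-1` _ = set0) ?measurable0//; apply/seteqP; split=> // x [].
have [nm|nm] := pselect (n = m).
  case: _ / nm; rewrite (_ : _ @^-1` _ = A)//; apply/seteqP; split=> x /=.
    by move=> [y Ay /Comp_inj <-].
  by exists x.
rewrite (_ : _ @^-1` _ = set0) ?measurable0//; apply/seteqP; split=> // x [y _ [E _]].
exact: nm.
Qed.

Lemma measurable_image_Digits (A : set C) : measurable A -> measurable (Digits @` A).
Proof.
move=> mA; split=> [m|].
  by rewrite (_ : _ @^-1` _ = set0) ?measurable0//; apply/seteqP; split=> // x [].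
rewrite (_ : _ @^-1` _ = A)//; apply/seteqP; split=> x /=.
  by move=> [y Ay /Digits_inj <-].
by exists x.
Qed.

Lemma measurable_Root b : measurable [set Root b].
Proof.
by split=> [m|]; rewrite (_ : _ @^-1` _ = set0) ?measurable0//; apply/seteqP; split.
Qed.

End GlueSpace.

(** Transfers generation from a summand to the sum. Complements in X become complements relative to
    [range f], which is why [range f] must lie in S. *)
Lemma sigma_algebra_image (X Y : Type) (f : X -> Y) (G : set (set X)) (S : set (set Y)) :
  injective f -> sigma_algebra setT S -> S (range f) ->
  (forall A, G A -> S (f @` A)) -> forall A, <<s G >> A -> S (f @` A).
Proof.
move=> fI [S0 SD SU] ST SG.
have SI A B : S A -> S B -> S (A `\` B).
  move=> SA SB; rewrite (_ : A `\` B = setT `\` \bigcup_i (if i is 0%N then setT `\` A else B)).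
    by apply: (SD); apply: SU => -[|i] //; exact: SD.
  apply/seteqP; split=> y.
    by move=> [Ay nBy]; split=> // -[[|i] _] // [].
  move=> [_ nU]; split; last by move=> By; apply: nU; exists 1%N.
  by apply: contrapT => nA; apply: nU; exists 0%N.
apply: (@smallest_sub _ _ G [set A | S (f @` A)]); last exact: SG.
split=> /= [|A SA|F SF]; first by rewrite image_set0.
  rewrite (_ : f @` _ = range f `\` f @` A); first exact: SI.
  apply/seteqP; split=> y.
    by move=> [x [_ nAx] <-]; split; [exists x|move=> [x' Ax' /fI xx']; apply: nAx; rewrite -xx'].
  by move=> [[x _ <-] nAx]; exists x => //; split=> // Ax; apply: nAx; exists x.
by rewrite image_bigcup; exact: SU.
Qed.

Lemma separable_glue (d : nat -> measure_display) (T : forall n, measurableType (d n))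
    (dC : measure_display) (C : measurableType dC) :
  (forall n, @separable _ (T n)) -> @separable _ C -> @separable _ (glue T C).
Proof.
move=> sepT [[GC [mGC GCE]] sepC]; split; last first.
  move=> x y nxy.
  case: x nxy => [n x|x|b] nxy; last first.
    by exists [set Root T C b]; split; [exact: measurable_Root|split=> // /esym].
    case: y nxy => [m y|y|b] nxy.
    - exists (range (@Digits _ T _ C)); split; first exact/measurable_image_Digits/measurableT.
      by split; [exists x|move=> []].
    - have [xy|A [mA [Ax nAy]]] := sepC x y; first by apply: nxy; rewrite xy.
      exists (@Digits _ T _ C @` A); split; first exact: measurable_image_Digits.
      by split; [exists x|move=> [z Az [zy]]; apply: nAy; rewrite -zy].
    - exists (range (@Digits _ T _ C)); split; first exact/measurable_image_Digits/measurableT.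
      by split; [exists x|move=> []].
  have [[z yE]|ny] := pselect (exists z : T n, y = Comp C z); last first.
    exists (range (@Comp _ T _ C n)); split; first exact/measurable_image_Comp/measurableT.
    by split; [exists x|move=> [z _ zy]; apply: ny; exists z].
  rewrite {y}yE in nxy *.
  have [xz|A [mA [Ax nAz]]] := (sepT n).2 x z; first by apply: nxy; rewrite xz.
  exists (@Comp _ T _ C n @` A); split; first exact: measurable_image_Comp.
  by split; [exists x|move=> [u Au /Comp_inj uz]; apply: nAz; rewrite -uz].
pose GT n := sval (cid (sepT n).1).
have GTP n : (forall k, measurable (GT n k)) /\
    (forall A, measurable A <-> <<s range (GT n) >> A) := svalP (cid (sepT n).1).
(* Countably many generators: those of every summand, each summand as a whole so that relative
   complements are available, and the two roots. *)
pose gen (c : nat * option nat + option nat + bool) : set (glue T C) :=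
  match c with
  | inl (inl (n, Some k)) => @Comp _ T _ C n @` GT n k
  | inl (inl (n, None)) => range (@Comp _ T _ C n)
  | inl (inr (Some k)) => @Digits _ T _ C @` GC k
  | inl (inr None) => range (@Digits _ T _ C)
  | inr b => [set Root T C b]
  end.
pose gens i := oapp gen set0 (unpickle i).
have mgens i : measurable (gens i).
  rewrite /gens; case: (unpickle i) => [[[[n [k|]]|[k|]]|b]|] /=.
  - exact/measurable_image_Comp/(GTP n).1.
  - exact/measurable_image_Comp/measurableT.
  - exact/measurable_image_Digits.
  - exact/measurable_image_Digits/measurableT.
  - exact: measurable_Root.
  - exact: measurable0.
exists gens; split=> // A; split; last first.
  apply: smallest_sub; last by move=> _ [i _ <-].
  split; first exact: measurable0.
    by move=> B mB; rewrite setTD; exact: measurableC.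
  by move=> F mF; exact: bigcupT_measurable.
move=> [mA mAC]; pose S := <<s range gens >>.
have saS : sigma_algebra setT S by exact: smallest_sigma_algebra.
have Sgen c : S (gen c).
  by apply: sub_sigma_algebra; exists (pickle c) => //; rewrite /gens pickleK.
pose Y : measurableType _ := g_sigma_algebraType (range gens).
have S1 n : S (@Comp _ T _ C n @` (@Comp _ T _ C n @^-1` A)).
  apply: (@sigma_algebra_image _ _ _ (range (GT n))) => //.
  - exact: Comp_inj.
  - exact: (Sgen (inl (inl (n, None)))).
  - by move=> _ [k _ <-]; exact: (Sgen (inl (inl (n, Some k)))).
  - by apply/(GTP n).2; exact: mA.
have S2 : S (@Digits _ T _ C @` (@Digits _ T _ C @^-1` A)).
  apply: (@sigma_algebra_image _ _ _ (range GC)) => //.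
  - exact: Digits_inj.
  - exact: (Sgen (inl (inr None))).
  - by move=> _ [k _ <-]; exact: (Sgen (inl (inr (Some k)))).
  - by apply/GCE; exact: mAC.
have S3 b : S ([set Root T C b] `&` A).
  have [Ab|nAb] := pselect (A (Root T C b)).
    by rewrite setIidl; [exact: (Sgen (inr b))|move=> _ ->].
  rewrite (_ : _ `&` _ = set0); first exact: (@measurable0 _ Y).
  by apply/seteqP; split=> // _ [-> /nAb].
have -> : A = (\bigcup_n (@Comp _ T _ C n @` (@Comp _ T _ C n @^-1` A))) `|`
    (@Digits _ T _ C @` (@Digits _ T _ C @^-1` A)) `|`
    ([set Root T C true] `&` A) `|` ([set Root T C false] `&` A).
  apply/seteqP; split=> [[n x|x|b] Ax|s].
  - by left; left; left; exists n => //; exists x.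
  - by left; left; right; exists x.
  - by case: b Ax => Ax; [left; right|right].
  - by move=> [[[[n _ [x Ax <-]]|[x Ax <-]]|[]]|[]].
apply: (@measurableU _ Y); last exact: S3.
apply: (@measurableU _ Y); last exact: S3.
apply: (@measurableU _ Y); last exact: S2.
by apply: (@bigcupT_measurable _ Y) => n; exact: S1.
Qed.

Section Separation.
Context {R : realType} {d : measure_display} {T : measurableType d}
  {L : countType} (tau : L -> R.-spker T ~> T).

(* State bisimilarity is separated by its own measurable closed sets, because
   the level sets of the kernels on closed sets are again closed. *)
Lemma sim_s_separated s t :
  (forall F, SigmaR (sim_s tau) F -> (F s <-> F t)) -> sim_s tau s t.
Proof.
pose Rel x y := forall F, SigmaR (sim_s tau) F -> (F x <-> F y).
have sub x y : sim_s tau x y -> Rel x y.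
  by move=> xy F [mF cF]; split=> Fx; apply: cF Fx _ => //; exact: sim_s_sym.
apply: (@post_fixpoint_sim_s _ _ _ _ tau Rel).
  by move=> x y xy F cF; apply: iff_sym; exact: xy.
move=> x y xy a E [mE cE].
have [|+ _] := xy [set u | tau a u E = tau a x E]; last by move=> /(_ erefl) /= ->.
split.
  have := measurable_kernel (tau a) E mE measurableT _
    (emeasurable_set1 (tau a x E)).
  by rewrite setTI.
move=> u v /= <- uv; apply/esym/(sim_s_Oop uv); split=> // z w Ez zw.
by apply: cE Ez _; exact: sub.
Qed.

End Separation.

(** Induction on N: A is cut along [G N], and each half is the trace of a slice that depends on the
    first N sets only. For N = 0 the set is empty or everything. *)
Lemma finitely_determined_sigma (C : Type) (G : nat -> set C) N (A : set C) :
  (forall x y, (forall k, (k < N)%N -> (G k x <-> G k y)) -> A x -> A y) ->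
  <<s range G >> A.
Proof.
have sG := smallest_sigma_algebra setT (range G).
have sC B : <<s range G >> B -> <<s range G >> (~` B).
  by case: sG => _ + _ => /(_ B); rewrite setTD; apply.
have sU B B' : <<s range G >> B -> <<s range G >> B' -> <<s range G >> (B `|` B').
  move=> sB sB'; rewrite -bigcup2E; case: sG => s0 _; apply.
  by move=> [|[|i]].
have sI B B' : <<s range G >> B -> <<s range G >> B' -> <<s range G >> (B `&` B').
  by move=> sB sB'; rewrite -[B `&` B']setCK setCI; apply: (sC); apply: sU; exact: sC.
elim: N A => [|N IH] A invA.
  have [[x Ax]|nA] := pselect (exists x, A x).
    rewrite (_ : A = ~` set0); first by apply: sC; case: sG.
    by rewrite setC0; apply/seteqP; split=> // y _; exact: invA Ax.
  rewrite (_ : A = set0); first by case: sG.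
  by apply/seteqP; split=> // x Ax; apply: nA; exists x.
pose slice (P : set C) := [set x | exists2 y, A y /\ P y &
  forall k, (k < N)%N -> (G k y <-> G k x)].
have sslice P : <<s range G >> (slice P).
  apply: IH => x x' xx' [y Py yx]; exists y => // k kN.
  exact: iff_trans (yx k kN) (xx' k kN).
have sGN : <<s range G >> (G N) by apply: sub_sigma_algebra; exists N.
rewrite (_ : A = (G N `&` slice (G N)) `|` (~` G N `&` slice (~` G N))).
  by apply: sU; apply: sI => //; exact: sC.
apply/seteqP; split=> x.
  move=> Ax; have [Gx|Gx] := pselect (G N x); [left|right];
  by split=> //; exists x.
move=> [|] [Gx [y [Ay Gy] yx]]; apply: invA Ay => k; rewrite ltnS leq_eqVlt =>
  /predU1P[->|/yx//]; by split.
Qed.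

(** * The glued process and its two roots *)

Section GlueProcess.
Context {R : realType} {d : nat -> measure_display}.
Variables (T : forall n, measurableType (d n)) (L : nat -> countType).
Variable tau : forall n, L n -> R.-spker (T n) ~> (T n).
Variables sp tp : forall n, T n.
Variables (dC : measure_display) (C : measurableType dC) (G : nat -> set C).
Variable mu : bool -> {measure set C -> \bar R}.
Hypothesis mG : forall n, measurable (G n).
Hypothesis mu1 : forall b, (mu b setT <= 1)%E.

(* Labels: [Act k] runs the action coded by k of the current component,
   [Mark n] recognises component n, [Digit k] moves from a point x of C to sp k
   or tp k according to whether x is in G k, [Throw] throws the measure attached
   to a root. *)
Definition glabel := (nat + nat + (nat + unit))%type.
Notation Act k := (inl (inl k)).
Notation Mark k := (inl (inr k)).
Notation Digit k := (inr (inl k)).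
Notation Throw := (inr (inr tt)).

Local Notation X := (glue T C).
Local Notation comp n := (@Comp _ T _ C n).

Local Notation point_mass z := (dirac z : {measure set X -> \bar R}).
Local Notation no_mass := (mzero : {measure set X -> \bar R}).

Definition glue_fun (l : glabel) (s : X) : {measure set X -> \bar R} :=
  match l, s with
  | Act k, Comp n x =>
      if (unpickle k : option (L n)) is Some a
      then push_measure (tau a x) (@measurable_Comp _ T _ C n) else no_mass
  | Mark m, Comp n _ => if n == m then point_mass (Root T C true) else no_mass
  | Digit k, Digits x =>
      if x \in G k then point_mass (comp k (sp k)) else point_mass (comp k (tp k))
  | inr (inr _), Root b => push_measure (mu b) (@measurable_Digits _ T _ C)
  | _, _ => no_mass
  end.

Lemma glue_fun_measurable l U : measurable U -> measurable_fun setT (glue_fun l ^~ U).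
Proof.
move=> mU; apply: measurable_fun_glue => [n|]; case: l => [[k|k]|[k|u]] /=;
  try exact: measurable_cst.
- case: (unpickle k) => [a|]; last exact: measurable_cst.
  by apply: measurable_kernel; exact: mU.1.
- rewrite (_ : (fun x => _) = (fun x => if x \in G k then
    dirac (comp k (sp k)) U else dirac (comp k (tp k)) U)); last first.
    by apply/funext => x; case: ifP.
  apply: measurable_fun_ifT => //; apply: (measurable_fun_bool true).
  rewrite setTI (_ : _ @^-1` _ = G k)//.
  by apply/seteqP; split=> x /=; [move/set_mem|move/mem_set].
Qed.

Lemma glue_fun_le1 l s : (glue_fun l s setT <= 1)%E.
Proof.
have d1 z : (dirac z setT <= 1 :> \bar R)%E by rewrite diracT.
case: l s => [[k|k]|[k|u]] [n x|x|b] //=; try exact: lee01.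
- case: (unpickle k) => [a|]; last exact: lee01.
  exact: sprob_kernel_le1.
- by case: ifP => _; [exact: d1|exact: lee01].
- by case: ifP => _; exact: d1.
- exact: mu1.
Qed.

HB.instance Definition _ l := isKernel.Build _ _ X X R (glue_fun l) (@glue_fun_measurable l).
HB.instance Definition _ l := Kernel_isSubProbability.Build _ _ X X R (glue_fun l)
  ((sprob_kernelP (fun x A => glue_fun l x A)).2 (@glue_fun_le1 l)).

Definition glue_tau (l : glabel) : R.-spker X ~> X := glue_fun l.

Lemma glue_tauE l s U : glue_tau l s U = glue_fun l s U.
Proof. by []. Qed.

(** Labels other than [Act] give constant truth values on a component. The empty set is a separate
    alternative because a component without labels has no formula denoting it. *)
Lemma den_Comp n phi : wf_formula phi ->
  (exists2 psi, wf_formula psi & comp n @^-1` den glue_tau phi = den (@tau n) psi) \/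
  comp n @^-1` den glue_tau phi = set0.
Proof.
have cst (P : Prop) : (exists2 psi, wf_formula psi & [set x : T n | P] = den (@tau n) psi) \/
    [set x : T n | P] = set0.
  have [p|np] := pselect P; [left; exists FTop => //|right];
  by apply/seteqP; split.
elim: phi => [_|p IHp q IHq [/IHp Hp /IHq Hq]|l q p IHp /= [q01 /IHp Hp]].
- by left; exists FTop.
- rewrite /= preimage_setI.
  case: Hp => [[p' wp ->]|->]; last by right; rewrite set0I.
  case: Hq => [[q' wq ->]|->]; last by right; rewrite setI0.
  by left; exists (FAnd p' q').
case: l => [[k|k]|[k|u]]; last 3 first.
- exact: (cst ((ratr q)%:E < glue_fun (Mark k) (comp n point) (den glue_tau p))%E).
- exact: (cst ((ratr q)%:E < glue_fun (Digit k) (comp n point) (den glue_tau p))%E).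
- exact: (cst ((ratr q)%:E < glue_fun Throw (comp n point) (den glue_tau p))%E).
have -> : comp n @^-1` [set s | ((ratr q)%:E < glue_tau (Act k) s (den glue_tau p))%E] =
    [set x | ((ratr q)%:E < if (unpickle k : option (L n)) is Some a
      then tau a x (comp n @^-1` den glue_tau p) else 0)%E].
  apply/seteqP; split=> x /=;
  by case: (unpickle k : option (L n)).
case: (unpickle k : option (L n)) => [a|]; last exact: cst.
case: Hp => [[p' wp ->]|->]; first by left; exists (FDiam a q p').
(* A diamond over the empty set fails because its threshold q is nonnegative. *)
right; apply/seteqP; split=> x //=; rewrite measure0 lte_fin ltNge.
by have /andP[q0 _] := q01; rewrite ler0q q0.
Qed.

Lemma Comp_sim_e n x y : sim_e (@tau n) x y -> sim_e glue_tau (comp n x) (comp n y).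
Proof.
move=> xy; apply/sim_eP => phi /(den_Comp n) [[psi wpsi E]|E].
  have Ez z : den glue_tau phi (comp n z) = den (@tau n) psi z by rewrite -E.
  by rewrite !Ez; exact: ((sim_eP _ _ _).1 xy).
have Ez z : den glue_tau phi (comp n z) = (set0 : set (T n)) z by rewrite -E.
by rewrite !Ez.
Qed.

Lemma Comp_iterO (W : WO) (w : W) n x y :
  iterO (@tau n) w x y -> iterO glue_tau w (comp n x) (comp n y).
Proof.
elim/(well_founded_ind (@wlt_wf W)): w x y => w IH x y /iterOP[xy wP].
apply/iterOP; split; first exact: Comp_sim_e.
move=> v vw l E [mE cE]; case: l => [[k|k]|[k|u]] //; rewrite !glue_tauE /=.
case: (unpickle k : option (L n)) => [a|//].
apply: (wP v vw a); split; first exact: mE.1.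
by move=> z z' /= Ez zz'; apply: cE Ez _; exact: IH.
Qed.

(** [Mark n] has mass 1 exactly on component n, so bisimilar points never leave the component and
    the image of a closed set is closed in the sum. *)
Lemma Comp_sim_s n x y : sim_s glue_tau (comp n x) (comp n y) -> sim_s (@tau n) x y.
Proof.
move: x y; apply: post_fixpoint_sim_s => [x y|x y xy a E [mE cE]]; first exact: sim_s_sym.
have := sim_s_Oop xy (Act (pickle a)) (E := comp n @` E).
rewrite !glue_tauE /= pickleK /= /pushforward.
have -> : comp n @^-1` (comp n @` E) = E.
  by apply/seteqP; split=> z /=; [move=> [z' Ez' /Comp_inj <-]|exists z].
apply; split; first exact: measurable_image_Comp.
move=> _ s [z Ez <-] zs; have := sim_s_Oop zs (Mark n) (SigmaR_setT _).
rewrite !glue_tauE /= eqxx /= diracT.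
case: s zs => [m z'|z'|b] zs /=; last first.
- by move=> /eqP; rewrite onee_eq0.
- by move=> /eqP; rewrite onee_eq0.
case: eqP => [mn|_]; last by move=> /eqP; rewrite onee_eq0.
move=> _; move: (esym mn) => {mn} nm; case: m / nm z' zs => z' zs.
by exists z' => //; apply: cE Ez _.
Qed.

(** Only [Digit k] acts on C: below N both points move to the same state, and from N on E does not
    distinguish the two targets. *)
Lemma glue_fun_Digits N x y (E : set X) l :
  (forall k, (k < N)%N -> (G k x <-> G k y)) ->
  (forall k, (N <= k)%N -> (E (comp k (sp k)) <-> E (comp k (tp k)))) ->
  glue_fun l (Digits T x) E = glue_fun l (Digits T y) E.
Proof.
move=> xy EN; case: l => [[k|k]|[k|u]] //=.
have [kN|Nk] := ltnP k N.
  suff -> : (x \in G k) = (y \in G k) by [].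
  by apply/idP/idP => /set_mem /(xy k kN) /mem_set.
have Ek : \d_(comp k (sp k)) E = \d_(comp k (tp k)) E :> \bar R.
  rewrite !diracE; congr (_%:R%:E); congr nat_of_bool.
  by apply/idP/idP => /set_mem /(EN k Nk) /mem_set.
by case: ifP => _; case: ifP => _ /=.
Qed.

Lemma Digits_iterO (W : WO) (w : W) N x y :
  (forall k, (N <= k)%N -> iterO (@tau k) w (sp k) (tp k)) ->
  (forall k, (k < N)%N -> (G k x <-> G k y)) ->
  iterO glue_tau w (Digits T x) (Digits T y).
Proof.
move=> it xy.
have itk (v : W) k : (N <= k)%N -> wlt v w -> iterO glue_tau v (comp k (sp k)) (comp k (tp k)).
  by move=> /it ik vw; apply: Comp_iterO; exact: (uniform_decr (@iterOP _ _ _ _ (@tau k) W)) vw ik.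
apply/iterOP; split.
  apply/sim_eP; elim=> [//|p IHp q IHq|l q p _] /=.
    by move=> [/IHp pE /IHq qE]; split=> -[/pE ? /qE].
  move=> [_ wp]; rewrite !glue_tauE (@glue_fun_Digits N x y)// => k /it ik.
  apply: (((sim_eP _ _ _).1 _) p wp).
  by apply: Comp_sim_e; exact: (uniform_sim_e (@iterOP _ _ _ _ (@tau k) W)) ik.
move=> v vw l E [mE cE]; rewrite !glue_tauE; apply: glue_fun_Digits xy _ => k Nk.
have kk := itk v k Nk vw.
by split=> Ek; apply: cE Ek _ => //; exact: (uniform_sym (@iterOP _ _ _ _ glue_tau W)).
Qed.

Hypothesis mu_agree : forall E, <<s range G >> E -> mu true E = mu false E.

(** On C each diamond reads at most one digit, whatever its subformula, so a formula depends on
    finitely many of the [G k]. *)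
Lemma den_Digits phi : <<s range G >> (@Digits _ T _ C @^-1` den glue_tau phi).
Proof.
suff [N HN] : exists N, forall x y, (forall k, (k < N)%N -> (G k x <-> G k y)) ->
    (den glue_tau phi (Digits T x) <-> den glue_tau phi (Digits T y)).
  by apply: (@finitely_determined_sigma _ _ N) => x y xy; exact: (HN x y xy).1.
elim: phi => [|p [N HN] q [M HM]|l q p _].
- by exists 0%N.
- exists (maxn N M) => x y xy /=.
  have HNx : den glue_tau p (Digits T x) <-> den glue_tau p (Digits T y).
    by apply: HN => k kN; apply: xy; rewrite leq_max kN.
  have HMx : den glue_tau q (Digits T x) <-> den glue_tau q (Digits T y).
    by apply: HM => k kN; apply: xy; rewrite leq_max kN orbT.
  by split=> -[/HNx ? /HMx].
- exists (if l is Digit k then k.+1 else 0%N) => x y xy /=; rewrite !glue_tauE.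
  case: l xy => [[k|k]|[k|u]] xy //=.
  suff -> : (x \in G k) = (y \in G k) by [].
  by apply/idP/idP => /set_mem /(xy k (ltnSn k)) /mem_set.
Qed.

Lemma Root_sim_e : sim_e glue_tau (Root T C true) (Root T C false).
Proof.
apply/sim_eP; elim=> [//|p IHp q IHq|l q p _] /=.
  by move=> [/IHp pE /IHq qE]; split=> -[/pE ? /qE].
move=> _; rewrite !glue_tauE; case: l => [[k|k]|[k|u]] //=.
by rewrite /pushforward mu_agree//; exact: den_Digits.
Qed.

Lemma Root_Oop (W : WO) (w : W) N :
  (forall k, (N <= k)%N -> iterO (@tau k) w (sp k) (tp k)) ->
  Oop glue_tau (iterO glue_tau w) (Root T C true) (Root T C false).
Proof.
move=> it l E [mE cE]; rewrite !glue_tauE; case: l => [[k|k]|[k|u]] //=.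
rewrite /pushforward mu_agree//; apply: (@finitely_determined_sigma _ _ N) => x y xy Ex.
by apply: cE Ex _; exact: Digits_iterO it xy.
Qed.

Lemma Root_not_sim_s V : (forall x y, (forall n, G n x <-> G n y) -> x = y) ->
  (forall n, ~ sim_s (@tau n) (sp n) (tp n)) ->
  measurable V -> mu true V <> mu false V ->
  ~ sim_s glue_tau (Root T C true) (Root T C false).
Proof.
move=> sepG nst mV muV rr; apply: muV.
have := sim_s_Oop rr Throw (E := @Digits _ T _ C @` V).
rewrite !glue_tauE /= /pushforward.
have -> : @Digits _ T _ C @^-1` (@Digits _ T _ C @` V) = V.
  by apply/seteqP; split=> z /=; [move=> [z' Ez' [<-]]|exists z].
apply; split; first exact: measurable_image_Digits.
move=> _ s [x Vx <-] xs.
(* [Digit 0] has mass 1 exactly on points of C, so a state bisimilar to x lies in C. *)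
have := sim_s_Oop xs (Digit 0%N) (SigmaR_setT _).
rewrite !glue_tauE /=.
have -> : (if x \in G 0%N then point_mass (comp 0%N (sp 0%N))
  else point_mass (comp 0%N (tp 0%N))) setT = 1%E by case: ifP => _ /=; rewrite diracT.
case: s xs => [m z'|y|b] xs /=; [by move=> /eqP; rewrite onee_eq0| |
  by move=> /eqP; rewrite onee_eq0].
move=> _; suff -> : y = x by exists x.
apply: sepG => k.
(* If x and y differ on [G k], their moves on [Digit k] reach [sp k] and [tp k], which no closed set
   can then separate; so these would be bisimilar. *)
have st_sep (F : set X) : SigmaR (sim_s glue_tau) F ->
    ((x \in G k) != (y \in G k)) -> F (comp k (sp k)) <-> F (comp k (tp k)).
  move=> cF; have := sim_s_Oop xs (Digit k) cF; rewrite !glue_tauE /=.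
  have dE z z' : \d_z F = \d_z' F :> \bar R -> (F z <-> F z').
    rewrite !diracE => -[] /eqP; rewrite eqr_nat => /eqP zz'.
    have {}zz' : (z \in F) = (z' \in F) by case: (z \in F) (z' \in F) zz' => -[].
    by split=> /mem_set; [rewrite zz'|rewrite -zz'] => /set_mem.
  by case: ifP => _; case: ifP => _ //= /dE // [? ?]; split.
have [xy|nxy] := eqVneq (x \in G k) (y \in G k).
  by split=> /mem_set; [rewrite -xy|rewrite xy] => /set_mem.
exfalso; apply: (nst k); apply: Comp_sim_s; apply: sim_s_separated => F cF.
exact: st_sep.
Qed.

End GlueProcess.

(** * Cofinality of the supremum *)

Section TwoStates.
Variable R : realType.

Lemma separable_bool : @separable _ bool.
Proof.
split; last first.
  by move=> x y xy; exists [set x]; split=> //; split=> // yx; exact: xy.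
(* The two lowest bits of n say whether true and false belong to the n-th set. *)
exists (fun n => [set b : bool | if b then odd n else odd n./2]); split=> // A.
split=> // _; apply: sub_sigma_algebra.
exists (`[< A true >] + `[< A false >].*2)%N => //.
apply/seteqP; split=> -[] /=; rewrite ?half_bit_double ?oddD ?odd_double ?addbF ?oddb;
by move=> /asboolP.
Qed.

(** A seed process with two states that are not state bisimilar, to feed the gluing before any stage
    is known to be reached. *)
Definition step_fun (_ : unit) (b : bool) : {measure set bool -> \bar R} :=
  if b then (dirac true : {measure set bool -> \bar R})
  else (mzero : {measure set bool -> \bar R}).

Lemma step_fun_measurable l U : measurable U -> measurable_fun setT (step_fun l ^~ U).
Proof. by move=> _ _ A _. Qed.

Lemma step_fun_le1 l b : (step_fun l b setT <= 1)%E.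
Proof. by case: b => /=; [rewrite diracT|exact: lee01]. Qed.

HB.instance Definition _ l :=
  isKernel.Build _ _ bool bool R (step_fun l) (@step_fun_measurable l).
HB.instance Definition _ l := Kernel_isSubProbability.Build _ _ bool bool R (step_fun l)
  ((sprob_kernelP (fun x A => step_fun l x A)).2 (@step_fun_le1 l)).

Definition step_tau (l : unit) : R.-spker bool ~> bool := step_fun l.

Lemma step_tau_not_sim_s : ~ sim_s step_tau true false.
Proof.
move=> /sim_s_Oop /(_ tt _ (SigmaR_setT _)).
by rewrite /= diracT => /eqP; rewrite onee_eq0.
Qed.

End TwoStates.

Record distinguished_lmp (R : realType) := DistinguishedLMP {
  dl_disp : measure_display;
  dl_state : measurableType dl_disp;
  dl_label : countType;
  dl_tau : dl_label -> R.-spker dl_state ~> dl_state;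
  dl_sep : @separable _ dl_state;
  dl_fst : dl_state;
  dl_snd : dl_state;
  dl_neq : ~ sim_s dl_tau dl_fst dl_snd }.

Section Cofinality.
Variables (R : realType) (B : WO) (g : codes -> B).
Hypothesis gI : injective g.
Local Notation reached := (zhou_reached R (B := B)).

(** The unstable stages of the glued process are themselves reached, so under domination the roots
    would survive all of them and be related at its least stable stage, that is, be state
    bisimilar. *)
Lemma glue_overtakes (S : nat -> distinguished_lmp R) :
  ~ (forall v, reached v -> exists N, forall n, (N <= n)%N ->
       iterO (@dl_tau _ (S n)) v (dl_fst (S n)) (dl_snd (S n))).
Proof.
move=> dom; have [dC [C [G [mu [V [sepC mG sepG mu1 [agree [mV muV]]]]]]]] :=
  measures_agreeing_on_generators R.
pose tau := glue_tau (fun n => @dl_tau _ (S n)) (fun n => dl_fst (S n))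
  (fun n => dl_snd (S n)) mG mu1.
have sep := separable_glue (fun n => dl_sep (S n)) sepC.
have /wlt_least[b [/stableP stb bmin]] := separable_stable tau gI sep.
apply: (Root_not_sim_s (mG := mG) (mu1 := mu1) sepG (fun n => @dl_neq _ (S n)) mV muV).
apply: stb; apply/iterOP; split; first exact: Root_sim_e.
move=> v vb; have uv : unstable tau v by apply: contrapT => /bmin.
have [|N HN] := dom v; first by exists _, _, _, tau.
exact: Root_Oop HN.
Qed.

(** If nothing were reached, domination would hold vacuously. *)
Lemma exists_reached : exists b, reached b.
Proof.
apply: contrapT => nex.
pose S (n : nat) := DistinguishedLMP separable_bool (@step_tau_not_sim_s R).
apply: (@glue_overtakes S).
by move=> v rv; case: nex; exists v.
Qed.

(** Choose processes whose pairs survive stage [beta n]. Without such a v, every reached stage would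
    eventually be at most [beta n], so these pairs would survive it, against [glue_overtakes]. *)
Lemma reached_sequence (beta : nat -> B) : (forall n, reached (beta n)) ->
  exists2 v, reached v & forall N, exists2 n, (N <= n)%N & wlt (beta n) v.
Proof.
move=> rb; apply: contrapT => nex.
have ex n : exists S : distinguished_lmp R,
    iterO (@dl_tau _ S) (beta n) (dl_fst S) (dl_snd S).
  have [d [T [L [tau [sep [s [t [st nst]]]]]]]] := rb n.
  by exists (DistinguishedLMP sep nst).
have [S SP] := choice ex.
apply: (@glue_overtakes S) => v rv; apply: contrapT => nN; apply: nex.
exists v => // N; apply: contrapT => nn; apply: nN; exists N => n Nn.
have [bv|[<-//|vb]] := wlt_total (beta n) v; first by case: nn; exists n.
exact: (uniform_decr (@iterOP _ _ _ _ _ B)) vb (SP n).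
Qed.

(** Increasing bounded sets are the common form behind the three conclusions on K: the limit
    property, cofinality and uncountability each exclude one such cofinal sequence. *)
Lemma no_dominating_sequence (K := wo_sub reached) (P : nat -> set K) :
  (forall n, exists k : K, forall x, P n x -> ~ wlt k x) ->
  (forall m n, (m <= n)%N -> P m `<=` P n) ->
  ~ (forall k : K, exists n x, P n x /\ ~ wlt x k).
Proof.
move=> /choice[beta betaP] Pmono cofP.
have [v rv vP] := reached_sequence (fun n => svalP (beta n)).
have [N [x [Px nxv]]] := cofP (exist _ v rv).
have [n Nn bv] := vP N.
apply: (betaP n x (Pmono _ _ Nn _ Px)).
have [xv|[xv|vx]] := wlt_total (sval x) v; first by case: nxv.
  by rewrite /wlt /= xv.
exact: wlt_trans bv vx.
Qed.

End Cofinality.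

Theorem theorem4p8 (R : realType) :
  exists K : WO, is_sup_zhou R K /\
    wo_limit K /\ cof_gt_omega K /\ wo_uncountable K.
Proof.
have [lt [lt_wf lt_tr lt_tot]] := well_orderable codes.
pose B := Build_WO lt_wf lt_tr lt_tot; have gI : injective (id : codes -> B) by [].
have [b0 rb0] := @exists_reached R B id gI.
pose K := wo_sub (@zhou_reached R B); pose k0 : K := exist _ b0 rb0.
have ndom := @no_dominating_sequence R B id gI.
exists K; split; first exact: (@is_sup_zhou_reached R B id gI).
split; [split|split].
- by exists k0.
(* A greatest element k would make the constant sequence of singletons cofinal. *)
- move=> k; apply: contrapT => nk; apply: (ndom (fun=> [set k])).
  + by move=> _; exists k => _ ->; exact: wlt_irrefl.
  + by move=> m n _ x.
  + by move=> k'; exists 0%N, k; split=> // kk'; apply: nk; exists k'.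
- move=> X cofX [f fP]; apply: (ndom (fun n => [set x | X x /\ (f x < n)%N])).
  + elim=> [|n [k kP]]; first by exists k0 => x [].
    (* At most one element of X takes the value n, so the bound only has to be raised to it. *)
    have [[y [Xy fy]]|ny] := pselect (exists y, X y /\ f y = n); last first.
      exists k => x [Xx]; rewrite ltnS leq_eqVlt => /predU1P[fx|fx].
        by case: ny; exists x.
      exact: kP.
    have [z [_ zk zy]] := wo_max k y; exists z => x [Xx]; rewrite ltnS leq_eqVlt.
    move=> /predU1P[fx|fx]; last by apply: nwlt_trans zk _; exact: kP.
    apply: nwlt_trans zy _ => yx; have := fP _ _ Xy Xx yx.
    by rewrite fx fy ltnn.
  + by move=> m n mn x [Xx fx]; split=> //; exact: leq_trans fx mn.
  + move=> k; have [x [Xx kx]] := cofX k; exists (f x).+1, x; split=> //.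
    case: kx => [->|kx xk]; first exact: wlt_irrefl.
    exact: (wlt_irrefl (wlt_trans kx xk)).
- move=> [f fsurj]; apply: (ndom (fun n => [set x | exists2 i, (i < n)%N & f i = x])).
  + elim=> [|n [k kP]]; first by exists k0 => x [].
    have [z [_ zk zn]] := wo_max k (f n); exists z => x [i].
    rewrite ltnS leq_eqVlt => /predU1P[-> <-//|i_n fi].
    by apply: nwlt_trans zk _; apply: kP; exists i.
  + by move=> m n mn x [i im fi]; exists i => //; exact: leq_trans im mn.
  + by move=> k; have [n fn] := fsurj k; exists n.+1, k; split; [exists n|exact: wlt_irrefl].
Qed.
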